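(* Let $L$ be a $c$-step nilpotent Lie algebra over a field, with $\dim(L)=n$ finite and $\dim(\gamma_2(L))=m\geq 1$. Then $$\dim(M(L))\;\leq\;\frac{1}{2}(n-m-1)(n+m)-\sum_{i=2}^{\min(n-m,\,c)}(n-m-i).$$
   Context: $\gamma_i(L)$ denotes the $i$-th term of the lower central series of $L$: $\gamma_1(L)=L$ and $\gamma_{i+1}(L)=[\gamma_i(L),L]$. So $\gamma_2(L)=[L,L]$. $L$ is $c$-step nilpotent if $\gamma_{c+1}(L)=0$ and $\gamma_c(L)\neq 0$. All dimensions are vector space dimensions over the ground field. $M(L)$ denotes the Schur multiplier of $L$: if $L\cong F/R$ with $F$ a free Lie algebra and $R$ an ideal of $F$ (a free presentation of $L$), then $M(L)=(R\cap[F,F])/[R,F]$, which up to isomorphism does not depend on the chosen presentation. *)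

(* Defs.v *)
From HB Require Import structures.
From mathcomp Require Import all_boot all_order all_algebra.
From mathcomp Require Import boolp classical_sets.
Set Implicit Arguments.
Unset Strict Implicit.
Unset Printing Implicit Defensive.
Import GRing.Theory.
Local Open Scope ring_scope.
Local Open Scope classical_set_scope.

HB.mixin Record isLieAlgebra (K : fieldType) L of GRing.Lmodule K L := {
  lie : L -> L -> L;
  lie_linearl : forall y : L, linear (lie^~ y);
  lie_linearr : forall x : L, linear (lie x);
  lie_alt : forall x : L, lie x x = 0;
  lie_jacobi : forall x y z : L,
    lie x (lie y z) + lie y (lie z x) + lie z (lie x y) = 0
}.

#[short(type="lieAlgType")]
HB.structure Definition LieAlgebra (K : fieldType) :=
  { L of isLieAlgebra K L & GRing.Lmodule K L }.

(* Finite-dimensional Lie algebras. *)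
#[short(type="vectLieAlgType")]
HB.structure Definition VectLieAlgebra (K : fieldType) :=
  { L of LieAlgebra K L & Vector K L }.

Definition lie_morphism (K : fieldType) (L H : lieAlgType K)
    (f : {linear L -> H}) : Prop :=
  forall x y, f (lie x y) = lie (f x) (f y).

Section LowerCentralSeries.
Variables (K : fieldType) (L : vectLieAlgType K).
Implicit Types U V W : {vspace L}.

(* Same encoding as the product [prodv] of subspaces of an F-algebra; by
   bilinearity it is the span of all brackets, see [lie_prodvP]. *)
Definition lie_prodv U V : {vspace L} :=
  <<[seq lie u v | u <- vbasis U, v <- vbasis V]>>%VS.

Lemma lie_prodvP U V W :
  reflect (forall u v, u \in U -> v \in V -> lie u v \in W)
          (lie_prodv U V <= W)%VS.
Proof.
apply: (iffP span_subvP) => [sW u v uU vV | sW x].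
  pose lr x : {linear L -> L} := HB.pack (lie x)
    (GRing.isLinear.Build K L L _ (lie x) (lie_linearr x)).
  pose ll y : {linear L -> L} := HB.pack (lie^~ y)
    (GRing.isLinear.Build K L L _ (lie^~ y) (lie_linearl y)).
  rewrite (coord_vbasis uU) (coord_vbasis vV).
  rewrite -[lie _ _]/(ll _ _) linear_sum; apply: memv_suml => i _.
  rewrite linearZ; apply: memvZ => /=.
  rewrite -[lie _ _]/(lr _ _) linear_sum; apply: memv_suml => j _.
  rewrite linearZ; apply: memvZ => /=; apply: sW.
  by apply: allpairs_f; apply: mem_nth; rewrite size_tuple.
by case/allpairsP => -[u v] /= [uU vV ->]; apply: sW; apply: vbasis_mem.
Qed.

(* Indexed from 1: [lcs 1] is all of [L] and [lcs i.+1] is [[lcs i, L]] for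
   [0 < i]; the value [lcs 0] (also all of [L]) is irrelevant. *)
Definition lcs (i : nat) : {vspace L} :=
  iter i.-1 (fun U => lie_prodv U fullv) fullv.

Definition nilpotent_step (c : nat) : Prop :=
  lcs c.+1 = 0%VS /\ lcs c <> 0%VS.

End LowerCentralSeries.
Arguments lcs {K} L i.
Arguments nilpotent_step {K} L c.

Section Subspaces.
Variables (K : fieldType) (V : lmodType K).

Definition lin_span (S : set V) : set V :=
  [set x | exists (k : nat) (a : 'I_k -> K) (s : 'I_k -> V),
     (forall i, S (s i)) /\ x = \sum_i a i *: s i].

(* For subspaces [B] and [A] of [V] with [B] contained in [A]: the quotient
   [A / B] has dimension [d], i.e. a basis formed by the classes of [d]
   elements of [A]. *)
Definition quot_dim (A B : set V) (d : nat) : Prop :=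
  exists e : 'I_d -> V, (forall i, A (e i)) /\
    forall x, A x -> exists! a : 'rV[K]_d, B (x - \sum_i a 0 i *: e i).

End Subspaces.

Definition lie_comm (K : fieldType) (L : lieAlgType K) (A B : set L) : set L :=
  lin_span [set z | exists x y, [/\ A x, B y & z = lie x y]].

(* [F] is the free Lie algebra on [X], with [i] the insertion of generators. *)
Definition free_lie_on (K : fieldType) (F : lieAlgType K) (X : Type)
    (i : X -> F) : Prop :=
  forall (H : lieAlgType K) (f : X -> H),
    exists phi : {linear F -> H},
      [/\ lie_morphism phi, forall x, phi (i x) = f x
        & forall psi : {linear F -> H}, lie_morphism psi ->
            (forall x, psi (i x) = f x) -> psi =1 phi].

Definition free_lie (K : fieldType) (F : lieAlgType K) : Prop :=
  exists (X : Type) (i : X -> F), free_lie_on i.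

Section SchurMultiplier.
Variables (K : fieldType) (F L : lieAlgType K) (p : {linear F -> L}).

Definition lie_ker : set F := [set x | p x = 0].

(* [F / lie_ker] is identified with [L] through the surjection [p]. *)
Definition free_presentation : Prop :=
  [/\ free_lie F, lie_morphism p & forall y, exists x, p x = y].

(* [d] is the dimension of [(R `&` [F, F]) / [R, F]] with [R := lie_ker]. *)
Definition schur_multiplier_dim (d : nat) : Prop :=
  quot_dim (lie_ker `&` lie_comm setT setT) (lie_comm lie_ker setT) d.

End SchurMultiplier.

(* Main.v *)
Require Import Defs.
From HB Require Import structures.
From mathcomp Require Import all_boot all_order all_algebra.
From mathcomp Require Import boolp classical_sets.
From mathcomp Require Import zify ring lra.
Set Implicit Arguments.
Unset Strict Implicit.
Unset Printing Implicit Defensive.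
Import Order.TTheory GRing.Theory Num.Theory.
Local Open Scope ring_scope.

(** Write [d] for [n - m] and [R] for the kernel of [p], and let [P i]
    ([lcs_pre i] below) be the preimage in [F] of the [i]-th term of the lower
    central series of [L].  The ideals [[P i, F]] descend from [[F, F]] (for
    [i = 1]) to [[R, F]] (for
    [i = c + 1]), and [[F, F] / (R /\ [F, F])] is the derived algebra of [L], of
    dimension [m].  So the multiplier has dimension at most [N - m] as soon as
    [N] elements span [[F, F]] modulo [[R, F]] ([quot_dim_ker]), and [N] may be
    bounded one factor [[P i, F] / [P i.+1, F]] at a time
    ([derived_generators]).

    Choose [d] elements of [F] that lift a basis of [L] modulo its derived
    algebra.  The factor [i = 1] is spanned by the brackets of pairs of these
    letters, that is, by 'C(d, 2) elements.  For larger [i], write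
    [m_i] for the dimension of [P i / P i.+1]; the factor is spanned by the
    [m_i * d] brackets [[b, x]], where [b] runs over a basis of [P i] modulo
    [P i.+1] and [x] over the letters ([lcs_comm_span]).  This already gives
    [N <= 'C(d, 2) + m * d].

    The correction comes from the Jacobi identity.  For [i <= c] some
    left-normed word [w] of length [i] in the letters lies outside [P i.+1], so
    the basis may be chosen to contain [w].  For every [x] in [F], the bracket
    [[w, x]] is a combination of brackets [[u, t]] with [u] in [P i] and [t] a
    letter occurring in [w] ([lie_left_normed]).  Hence [[w, x]] is redundant
    whenever the letter [x] does not occur in [w]; as [w] involves at most [i]
    letters, at least [d - i] of the [m_i * d] generators can be dropped
    ([lcs_comm_generators]).  Summing over [2 <= i <= c] and subtracting [m]
    gives the bound. *)

(** * Linear subsets and spans *)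

Section LinearSets.
Local Open Scope classical_set_scope.
Variables (K : fieldType) (V : lmodType K).
Implicit Types (A B S T X Y : set V) (s t : seq V).

Definition linear_set S :=
  S 0 /\ forall (a : K) x y, S x -> S y -> S (a *: x + y).

Lemma linear_set0 S : linear_set S -> S 0.
Proof. by case. Qed.

Lemma linear_setD S x y : linear_set S -> S x -> S y -> S (x + y).
Proof. by case=> _ lS Sx Sy; rewrite -[x]scale1r; apply: lS. Qed.

Lemma linear_setZ S a x : linear_set S -> S x -> S (a *: x).
Proof. by case=> S0 lS Sx; rewrite -[_ *: _]addr0; apply: lS. Qed.

Lemma linear_setN S x : linear_set S -> S x -> S (- x).
Proof. by move=> lS Sx; rewrite -scaleN1r; apply: linear_setZ. Qed.

Lemma linear_setB S x y : linear_set S -> S x -> S y -> S (x - y).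
Proof. by move=> lS Sx Sy; apply: linear_setD => //; apply: linear_setN. Qed.

Lemma linear_set_sum S (I : Type) (r : seq I) (P : pred I) (f : I -> V) :
  linear_set S -> (forall i, P i -> S (f i)) -> S (\sum_(i <- r | P i) f i).
Proof.
by move=> lS Sf; apply: (big_ind S) => [|x y|//]; [case: lS|exact: linear_setD].
Qed.

Lemma sub_lin_span X : X `<=` lin_span X.
Proof.
by move=> x Xx; exists 1, (fun=> 1), (fun=> x); rewrite big_ord1 scale1r.
Qed.

Lemma lin_span_min X S : linear_set S -> X `<=` S -> lin_span X `<=` S.
Proof.
move=> lS XS _ [k [a [s [Xs ->]]]]; apply: linear_set_sum => // i _.
by apply: linear_setZ => //; apply/XS/Xs.
Qed.

Lemma lin_span_linear X : linear_set (lin_span X).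
Proof.
split=> [|a _ _ [k [b [s [Xs ->]]]] [l [c [t [Xt ->]]]]].
  by exists 0, (fun=> 0), (fun=> 0); rewrite big_ord0; split=> // -[].
exists (k + l), (fun i => match split i with inl j => a * b j | inr j => c j end),
  (fun i => match split i with inl j => s j | inr j => t j end); split.
  by move=> i; case: (split i).
rewrite big_split_ord scaler_sumr; congr (_ + _); apply: eq_bigr => i _.
  by rewrite (unsplitK (inl i : 'I_k + 'I_l)) scalerA.
by rewrite (unsplitK (inr i : 'I_k + 'I_l)).
Qed.
Hint Resolve lin_span_linear : core.

Lemma lin_spanS X Y : X `<=` Y -> lin_span X `<=` lin_span Y.
Proof.
by move=> XY; apply: lin_span_min => //; apply: subset_trans XY (@sub_lin_span _).
Qed.

Lemma lin_span_setU X B x : linear_set B -> lin_span (X `|` B) x ->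
  exists2 y, lin_span X y & B (x - y).
Proof.
move=> lB; apply: (@lin_span_min _ [set x | exists2 y, lin_span X y & B (x - y)]).
  split=> [|a u v [y Xy By] [z Xz Bz]].
    by exists 0; [exact: linear_set0 | rewrite subrr; exact: linear_set0].
  exists (a *: y + z); first by case: (lin_span_linear X) => _; apply.
  by rewrite opprD addrACA -scalerBr; case: lB => _; apply.
move=> u [Xu|Bu]; [exists u; first exact: sub_lin_span|exists 0].
- by rewrite subrr; exact: linear_set0.
- exact: linear_set0.
- by rewrite subr0.
Qed.

Lemma lin_span_seq s x : lin_span [set` s] x ->
  exists a : 'rV[K]_(size s), x = \sum_i a 0 i *: s`_i.
Proof.
apply: (@lin_span_min _
  [set x | exists a : 'rV[K]_(size s), x = \sum_i a 0 i *: s`_i]).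
  split=> [|a u v [b ->] [c ->]].
    by exists 0; rewrite big1 // => i _; rewrite mxE scale0r.
  exists (a *: b + c); rewrite scaler_sumr -big_split; apply: eq_bigr => i _ /=.
  by rewrite !mxE scalerDl scalerA.
move=> u /= su; have lt : (index u s < size s)%N by rewrite index_mem.
exists (delta_mx 0 (Ordinal lt)); rewrite (bigD1 (Ordinal lt)) //= mxE !eqxx.
rewrite scale1r nth_index // big1 ?addr0 // => i ne.
by rewrite mxE (negPf ne) andbF scale0r.
Qed.

End LinearSets.
#[global] Hint Resolve lin_span_linear : core.

Lemma linear_set_preimage (K : fieldType) (V W : lmodType K)
    (f : {linear V -> W}) (S : set W) :
  linear_set S -> linear_set (f @^-1` S)%classic.
Proof.
case=> S0 lS; split=> [|a x y]; rewrite /preimage /=; first by rewrite linear0.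
by rewrite linearP; apply: lS.
Qed.

(** In finite dimension a linear subset given by an arbitrary proposition is a
    [{vspace W}]: take an included subspace of maximal dimension.  This makes
    dimension arguments available for subsets that involve the
    infinite-dimensional algebra [F]. *)
Lemma linear_set_vspace (K : fieldType) (W : vectType K) (S : set W) :
  linear_set S -> exists U : {vspace W}, forall x, x \in U <-> S x.
Proof.
move=> lS; pose P n := `[< exists2 U : {vspace W},
  (forall x, x \in U -> S x) & \dim U = n >].
have exP : exists n, P n.
  exists 0%N; apply/asboolP; exists 0%VS; last by rewrite dimv0.
  by move=> x; rewrite memv0 => /eqP ->; apply: linear_set0 lS.
have ubP n : P n -> (n <= \dim {:W})%N.
  by case/asboolP => U _ <-; apply/dimvS/subvf.
case: (ex_maxnP exP ubP) => n /asboolP[U US dU] maxU.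
exists U => x; split; first exact: US.
move=> Sx; suff: P (\dim (U + <[x]>)%VS).
  move/maxU; rewrite -dU => le; have /eqP -> : (U == U + <[x]>)%VS.
    by rewrite eqEdim addvSl.
  by rewrite (subvP (addvSr _ _)) ?memv_line.
apply/asboolP; exists (U + <[x]>)%VS => // y.
case/memv_addP => u uU [_ /vlineP[k ->] ->].
by apply: linear_setD => //; [apply: US | apply: linear_setZ].
Qed.

(** * Dimension of the kernel of a map on a quotient *)

(** Everything is pulled back to coefficient vectors along the map [f] from
    the row space to [A] given by the generators [s].  The coefficient vectors
    sent to zero by [g \o f] form a subspace of dimension at most
    [size s - \dim U], and the wanted quotient is that subspace modulo the
    vectors that [f] sends into [B].  The lifted basis is the image under [f] of
    a basis of a complement [D]. *)
Lemma quot_dim_ker (K : fieldType) (V : lmodType K) (W : vectType K)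
    (g : {linear V -> W}) (A B : set V) (s : seq V) (U : {vspace W}) :
  linear_set A -> linear_set B ->
  (forall x, B x -> g x = 0) -> (forall x, x \in s -> A x) ->
  (A `<=` lin_span ([set` s] `|` B))%classic ->
  (forall y, y \in U -> exists2 x, A x & g x = y) ->
  exists2 d, quot_dim ([set x | g x = 0] `&` A)%classic B d
    & (d + \dim U <= size s)%N.
Proof.
move=> lA lB gB sA AsB UA.
pose phi (a : 'rV[K]_(size s)) : V := \sum_i a 0 i *: s`_i.
have phi_linear : linear phi.
  move=> k a b; rewrite /phi scaler_sumr -big_split; apply: eq_bigr => i _ /=.
  by rewrite !mxE scalerDl scalerA.
pose f : {linear 'rV[K]_(size s) -> V} := HB.pack phi
  (GRing.isLinear.Build K 'rV[K]_(size s) V _ phi phi_linear).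
have fA a : A (f a).
  by apply: linear_set_sum => // i _; apply: linear_setZ => //; apply/sA/mem_nth.
have decA x : A x -> exists a, B (x - f a).
  move/AsB/(lin_span_setU lB) => [_ /lin_span_seq[a ->] Bx].
  by exists a.
pose h := linfun (g \o f).
have hE a : h a = g (f a) by rewrite lfunE.
have [U0 U0P] : exists U0 : {vspace 'rV[K]_(size s)}, forall a, a \in U0 <-> B (f a).
  exact: (@linear_set_vspace _ _ _ (linear_set_preimage f lB)).
have U0h : (U0 <= lker h)%VS.
  by apply/subvP => a /U0P Ba; rewrite memv_ker hE gB.
pose D := (lker h :\: U0)%VS.
have DU0 : (D + U0 = lker h)%VS by rewrite addv_diff; apply/addv_idPl.
have Dh : (D <= lker h)%VS by rewrite -DU0 addvSl.
exists (\dim D); last first.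
  have := limg_ker_dim h fullv; rewrite capfv dimvf /dim /= mul1n => dimE.
  have : (U <= limg h)%VS.
    apply/subvP => y /UA[x /decA[a Ba] <-].
    have -> : g x = h a by apply/eqP; rewrite hE -subr_eq0 -linearB gB.
    exact/memv_img/memvf.
  by move/dimvS; have := dimvS Dh; lia.
exists (fun i => f (vbasis D)`_i); split=> [i|x [gx Ax]].
  split; last exact: fA.
  by apply/eqP; rewrite -hE -memv_ker (subvP Dh) // vbasis_mem ?memt_nth.
have eE (a : 'rV[K]_(\dim D)) :
    \sum_i a 0 i *: f (vbasis D)`_i = f (\sum_i a 0 i *: (vbasis D)`_i).
  by rewrite linear_sum; apply: eq_bigr => i _; rewrite linearZ.
have [a Ba] := decA x Ax.
have : a \in (D + U0)%VS.
  rewrite DU0 memv_ker hE; apply/eqP.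
  by have /eqP := gB _ Ba; rewrite linearB gx sub0r oppr_eq0 => /eqP.
case/memv_addP => a1 a1D [a2 /U0P Ba2 aE].
have Ba1 : B (x - f a1).
  have -> : x - f a1 = (x - f a) + f a2.
    by rewrite aE linearD opprD addrA subrK.
  exact: linear_setD.
exists (\row_i coord (vbasis D) i a1); split.
  rewrite eE; suff <- : a1 =
    \sum_i (\row_i coord (vbasis D) i a1) 0 i *: (vbasis D)`_i by [].
  by rewrite {1}(coord_vbasis a1D); apply: eq_bigr => i _; rewrite mxE.
move=> b; rewrite eE; set b1 := \sum_i _ => Bb.
have b1D : b1 \in D.
  by apply: memv_suml => i _; apply: memvZ; rewrite vbasis_mem ?memt_nth.
have : a1 - b1 \in (D :&: U0)%VS.
  rewrite memv_cap rpredB //=; apply/U0P.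
  have -> : f (a1 - b1) = (x - f b1) - (x - f a1).
    by rewrite linearB [RHS]addrC opprB addrA subrK.
  exact: linear_setB.
rewrite capv_diff memv0 subr_eq0 => /eqP ->.
apply/rowP => i; rewrite mxE coord_sum_free //; exact/basis_free/vbasisP.
Qed.

(** * Brackets and spans *)

Section LieSpans.
Local Open Scope classical_set_scope.
Variables (K : fieldType) (F : lieAlgType K).
Implicit Types (S X Y : set F) (x y z : F).

Lemma lie0l y : lie 0 y = 0.
Proof. by have := lie_linearl y (-1) 0 0; rewrite scaler0 addr0 scaleN1r addNr. Qed.

Lemma lie0r x : lie x 0 = 0.
Proof. by have := lie_linearr x (-1) 0 0; rewrite scaler0 addr0 scaleN1r addNr. Qed.

Lemma lieDl x y z : lie (x + y) z = lie x z + lie y z.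
Proof. by have := lie_linearl z 1 x y; rewrite !scale1r. Qed.

Lemma lieDr x y z : lie x (y + z) = lie x y + lie x z.
Proof. by have := lie_linearr x 1 y z; rewrite !scale1r. Qed.

Lemma lieC x y : lie x y = - lie y x.
Proof.
apply/eqP; rewrite -addr_eq0; have := lie_alt (x + y).
by rewrite lieDl !lieDr !lie_alt add0r addr0 => ->.
Qed.

Lemma lieNl x y : lie (- x) y = - lie x y.
Proof. by apply/eqP; rewrite -addr_eq0 -lieDl addNr lie0l. Qed.

Lemma lie_leibniz u s y : lie (lie u s) y = lie (lie u y) s + lie u (lie s y).
Proof.
have /eqP := lie_jacobi u s y; rewrite addr_eq0 => /eqP jac.
rewrite lieC -jac addrC; congr (_ + _).
by rewrite lieC (lieC y u) lieNl opprK.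
Qed.

Lemma lie_lin_span X Y S : linear_set S ->
  (forall x y, X x -> Y y -> S (lie x y)) ->
  forall x y, lin_span X x -> lin_span Y y -> S (lie x y).
Proof.
move=> lS XYS x y + Yy; move: x.
apply: (@lin_span_min _ _ _ [set x | S (lie x y)]).
  split=> [|a u v /= Su Sv]; first by rewrite /= lie0l; apply: linear_set0.
  by rewrite (lie_linearl y a u v); case: lS => _; apply.
move=> x Xx; move: y Yy; apply: (@lin_span_min _ _ _ [set y | S (lie x y)]).
  split=> [|a u v /= Su Sv]; first by rewrite /= lie0r; apply: linear_set0.
  by rewrite (lie_linearr x a u v); case: lS => _; apply.
by move=> y; apply: XYS.
Qed.

Lemma lie_comm_linear X Y : linear_set (lie_comm X Y).
Proof. exact: lin_span_linear. Qed.

Lemma mem_lie_comm X Y x y : X x -> Y y -> lie_comm X Y (lie x y).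
Proof. by move=> Xx Yy; apply: sub_lin_span; exists x, y. Qed.

(** As the bracket alternates, unordered pairs of distinct entries suffice. *)
Lemma lie_pairs_span (xs : seq F) : exists s : seq F,
  [/\ size s = 'C(size xs, 2), forall z, z \in s -> exists x y, z = lie x y
    & forall x y, x \in xs -> y \in xs -> lin_span [set` s] (lie x y)].
Proof.
elim: xs => [|x xs [s [sz sL sP]]]; first by exists [::].
exists ([seq lie x y | y <- xs] ++ s); split.
- by rewrite size_cat size_map sz binS bin1 addnC.
- move=> z; rewrite mem_cat => /orP[/mapP[y _ ->]|/sL //]; by exists x, y.
have xP y : y \in xs -> lin_span [set` [seq lie x y | y <- xs] ++ s] (lie x y).
  by move=> yxs; apply: sub_lin_span; rewrite /= mem_cat map_f.
move=> u v; rewrite !inE => /predU1P[->|uxs] /predU1P[->|vxs].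
- by rewrite lie_alt; apply: linear_set0.
- exact: xP.
- by rewrite lieC; apply: linear_setN => //; apply: xP.
apply: lin_spanS (sP _ _ uxs vxs) => z /= zs.
by rewrite mem_cat zs orbT.
Qed.

End LieSpans.

Lemma linear_set_image (K : fieldType) (V W : lmodType K)
    (f : {linear V -> W}) (S : set V) :
  linear_set S -> linear_set (f @` S)%classic.
Proof.
case=> S0 lS; split=> [|a _ _ [x Sx <-] [y Sy <-]].
  by exists 0; rewrite ?linear0.
by exists (a *: x + y); [apply: lS | rewrite linearP].
Qed.

Section Presentation.
Local Open Scope classical_set_scope.
Variables (K : fieldType) (L : vectLieAlgType K) (F : lieAlgType K).
Variable p : {linear F -> L}.
Hypotheses (pM : lie_morphism p) (pS : forall y, exists x, p x = y).

(** * The lower central series pulled back along a presentation *)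

(** Pulling back keeps the filtration inside [F], so that no quotient algebra
    has to be formed. *)
Definition lcs_pre (i : nat) : set F := [set x | p x \in lcs L i].

(** The shift of the index matters: for a [c]-step nilpotent [L], the set
    [lcs_comm 1] is [[F, F]] and [lcs_comm c.+1] is [[R, F]], with [R] the kernel
    of [p]. *)
Definition lcs_comm (i : nat) : set F := lie_comm (lcs_pre i) setT.

Lemma lcs_pre_linear i : linear_set (lcs_pre i).
Proof.
have lU : linear_set [set y | y \in lcs L i].
  by split=> [|a x y ? ?]; [apply: mem0v | apply: rpredD => //; apply: rpredZ].
exact: (linear_set_preimage p lU).
Qed.

Lemma lcs_comm_linear i : linear_set (lcs_comm i).
Proof. exact: lie_comm_linear. Qed.

Hint Resolve lcs_pre_linear lcs_comm_linear : core.

Lemma lcs_pre1 x : lcs_pre 1 x.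
Proof. exact: memvf. Qed.

Lemma ker_lcs_pre i x : p x = 0 -> lcs_pre i x.
Proof. by rewrite /lcs_pre /= => ->; apply: mem0v. Qed.

Lemma lie_lcs_pre i x y : (0 < i)%N -> lcs_pre i x -> lcs_pre i.+1 (lie x y).
Proof.
case: i => // i _ ix; rewrite /lcs_pre /= pM.
by apply: (lie_prodvP _ _ _ (subvv _)) => //; apply: memvf.
Qed.

Lemma lcs_comm_sub_pre i : (0 < i)%N -> lcs_comm i `<=` lcs_pre i.+1.
Proof.
move=> i0; apply: lin_span_min => // _ [x [y [ix _ ->]]].
exact: lie_lcs_pre.
Qed.

Lemma mem_lcs_comm i x y : lcs_pre i x -> lcs_comm i (lie x y).
Proof. by move=> ix; apply: mem_lie_comm. Qed.

(** That is, [P i.+1 = [P i, F] + R]: both sides contain the kernel [R], and they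
    have the same image in [L]. *)
Lemma lcs_pre_comm_ker i x : (0 < i)%N -> lcs_pre i.+1 x ->
  exists2 y, lcs_comm i y & p (x - y) = 0.
Proof.
case: i => // i _ ix.
have [U UP] := linear_set_vspace (linear_set_image p (lcs_comm_linear i.+1)).
have : p x \in U.
  apply: subvP ix; apply/lie_prodvP => u v ui _; apply/UP.
  have [[a au] [b bv]] := (pS u, pS v).
  exists (lie a b); last by rewrite pM au bv.
  by apply: mem_lcs_comm; rewrite /lcs_pre /= au.
by case/UP => y iy pyx; exists y; rewrite // linearB pyx subrr.
Qed.

(** Because of this inclusion, the second entry of a bracket in [[P i, F]] only
    matters modulo [P 2], where [d] letters suffice.  Modulo the kernel, [v] is a
    combination of brackets [[a, b]], and Jacobi turns [[u, [a, b]]] into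
    [[[u, a], b] - [[u, b], a]]. *)
Lemma lie_lcs_pre2 i u v : (0 < i)%N -> lcs_pre i u -> lcs_pre 2 v ->
  lcs_comm i.+1 (lie u v).
Proof.
move=> i0 iu /(@lcs_pre_comm_ker 1 _ isT)[y y1 vy].
rewrite -(subrK y v) lieDr; apply: linear_setD => //.
  rewrite lieC; apply: linear_setN => //.
  by apply: mem_lcs_comm; apply: ker_lcs_pre.
apply: (@lie_lin_span _ _ [set u] _ _ (lcs_comm_linear _)) y1 => //; last first.
  exact: sub_lin_span.
move=> _ _ -> [a [b [_ _ ->]]].
have -> : lie u (lie a b) = lie (lie u a) b - lie (lie u b) a.
  by rewrite (lie_leibniz u a b) addrC addKr.
by apply: linear_setB => //; apply: mem_lcs_comm; apply: lie_lcs_pre.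
Qed.

(** Expanding both entries of a bracket, every term in which one entry lies in
    the deeper part ([P i.+1] on the left, [P 2] on the right) falls into
    [[P i.+1, F]]. *)
Lemma lcs_comm_span (X B : set F) i : (0 < i)%N ->
  (forall x, lin_span (X `|` lcs_pre 2) x) -> B `<=` lcs_pre i ->
  lcs_pre i `<=` lin_span (B `|` lcs_pre i.+1) ->
  lcs_comm i `<=`
    lin_span ([set z | exists b x, [/\ B b, X x & z = lie b x]] `|` lcs_comm i.+1).
Proof.
move=> i0 spanX Bi spanB; apply: lin_span_min => // _ [u [v [iu _ ->]]].
apply: lie_lin_span (spanB _ iu) (spanX v) => // b x [Bb|ib] [Xx|x2].
- by apply: sub_lin_span; left; exists b, x.
- by apply: sub_lin_span; right; apply: lie_lcs_pre2 => //; apply: Bi.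
- by apply: sub_lin_span; right; apply: mem_lcs_comm.
- by apply: sub_lin_span; right; apply: mem_lcs_comm.
Qed.

Lemma map_lift (ys : seq L) : exists xs : seq F, map p xs = ys.
Proof.
elim: ys => [|y ys [xs <-]]; first by exists [::].
by have [x <-] := pS y; exists (x :: xs).
Qed.

Lemma lift_span (bs : seq F) i x : p x \in (<<map p bs>> + lcs L i)%VS ->
  lin_span ([set` bs] `|` lcs_pre i) x.
Proof.
have [U UP] := linear_set_vspace (linear_set_image p (lin_span_linear [set` bs])).
case/memv_addP => u ubs [v iv xE].
have /UP[y ybs yu] : u \in U.
  apply: subvP ubs; apply/span_subvP => _ /mapP[b bbs ->]; apply/UP.
  by exists b => //; apply: sub_lin_span.
rewrite -(subrK y x); apply: linear_setD => //.
  by apply: sub_lin_span; right; rewrite /lcs_pre /= linearB yu xE addrC addKr.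
by apply: lin_spanS ybs => z; left.
Qed.

(** * Left-normed words *)

Definition left_normed (xs : seq F) (i : nat) : set F := [set w | exists x0 l,
  [/\ {subset x0 :: l <= xs}, (size l).+1 = i & w = foldl lie x0 l]].

Lemma left_normed_pre xs i : left_normed xs i `<=` lcs_pre i.
Proof.
move=> _ [x0 [l [_ <- ->]]]; elim/last_ind: l => [|l x IH]; first exact: lcs_pre1.
by rewrite foldl_rcons size_rcons; apply: lie_lcs_pre.
Qed.

(** Left-normed words arise by bracketing on the right with one letter at a time,
    which is how [lcs_comm_span] passes from generators of [P i] to generators
    of [P i.+1]. *)
Lemma lcs_pre_left_normed xs i :
  (forall x, lin_span ([set` xs] `|` lcs_pre 2) x) -> (0 < i)%N ->
  lcs_pre i `<=` lin_span (left_normed xs i `|` lcs_pre i.+1).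
Proof.
move=> spanX; elim: i => // -[_ _ x _|i IH _ x /lcs_pre_comm_ker[//|y iy xy]].
  apply: lin_spanS (spanX x) => z [zxs|z2]; [left | by right].
  by exists z, [::]; split=> // u; rewrite inE => /eqP ->.
rewrite -(subrK y x); apply: linear_setD => //.
  by apply: sub_lin_span; right; apply: ker_lcs_pre.
apply: lin_spanS (lcs_comm_span _ spanX _ (IH _) iy) => //; last first.
  exact: left_normed_pre.
move=> v [[b [z [[x0 [l [lxs szl ->]]] zxs ->]]]|]; last first.
  by move/(lcs_comm_sub_pre (ltn0Sn i.+1)); right.
left; exists x0, (rcons l z); rewrite foldl_rcons size_rcons szl.
split=> // u; rewrite -rcons_cons mem_rcons inE => /predU1P[->//|]; exact: lxs.
Qed.

(** The source of the redundancy: bracketing a word with an arbitrary element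
    can be traded for bracketing with the letters of that word.  Write the word
    as [[u, s]] with last letter [s]; then
    [[[u, s], y] = [[u, y], s] + [u, [s, y]]].  The first term ends in the letter
    [s], and the second is the same problem for the shorter word [u], with [y]
    replaced by [[s, y]] one step deeper, which is why [k] is kept general. *)
Lemma lie_left_normed x0 l y k : (0 < k)%N -> lcs_pre k y ->
  lin_span [set z | exists u s,
    [/\ lcs_pre (size l + k) u, s \in x0 :: l & z = lie u s]]
    (lie (foldl lie x0 l) y).
Proof.
move: y k; elim/last_ind: l => [|l s IH] y k k0 ky.
  rewrite lieC; apply: linear_setN => //; apply: sub_lin_span.
  by exists y, x0; rewrite mem_head.
rewrite foldl_rcons lie_leibniz size_rcons; apply: linear_setD => //.
  apply: sub_lin_span; exists (lie (foldl lie x0 l) y), s.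
  rewrite -rcons_cons mem_rcons mem_head; split=> //.
  rewrite addSn; apply: lcs_comm_sub_pre; first by rewrite addn_gt0 k0 orbT.
  apply: lin_span_min (IH _ _ k0 ky) => // _ [u [t [ku _ ->]]].
  exact: mem_lcs_comm.
have : lcs_pre k.+1 (lie s y).
  by rewrite lieC; apply: linear_setN => //; apply: lie_lcs_pre.
move/IH => /(_ isT); apply: lin_spanS => _ [u [t [ku tl ->]]].
exists u, t; split=> //; first by rewrite addSnnS.
by rewrite -rcons_cons mem_rcons inE tl orbT.
Qed.

(** * Counting generators of the successive factors *)

Lemma lcs_succ (i : nat) : (0 < i)%N -> lcs L i.+1 = lie_prodv (lcs L i) fullv.
Proof. by case: i. Qed.

Lemma lcs_succ_sub i : (lcs L i.+1 <= lcs L i)%VS.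
Proof.
case: i => [|i]; first exact: subvf.
elim: i => [|i IH]; first exact: subvf.
rewrite (lcs_succ (ltn0Sn i.+1)); apply/lie_prodvP => u v iu _.
rewrite lcs_succ //; apply: (lie_prodvP _ _ _ (subvv _)) (memvf v).
exact: (subvP IH).
Qed.

Lemma lcs_stationary i j : (0 < i)%N -> lcs L i.+1 = lcs L i ->
  lcs L (i + j) = lcs L i.
Proof.
move=> i0 st; elim: j => [|j IH]; first by rewrite addn0.
by rewrite addnS lcs_succ ?addn_gt0 ?i0 // IH -lcs_succ.
Qed.

(** Once the lower central series repeats a term it stays constant, so it can
    only reach zero by strict descent. *)
Lemma nilpotent_lcs_neq c i : nilpotent_step L c -> (0 < i <= c)%N ->
  ~ (lcs L i <= lcs L i.+1)%VS.
Proof.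
case=> c1 c0 /andP[i0 ic] le.
have st : lcs L i.+1 = lcs L i by apply/eqP; rewrite eqEsubv lcs_succ_sub.
by apply: c0; rewrite -c1 -(subnKC ic) -addnS !lcs_stationary.
Qed.

(** The generators are all brackets of a letter with an element of a basis of
    [P i] modulo [P i.+1], except that a basis element [w] which is a word is
    bracketed only with its own letters.  The inequality is the count
    [m_i * size xs - (size xs - i)], where [m_i] is the drop in dimension from
    [lcs L i] to [lcs L i.+1], arranged to telescope over [i]. *)
Lemma lcs_comm_generators c (xs : seq F) i :
  nilpotent_step L c -> (forall x, lin_span ([set` xs] `|` lcs_pre 2) x) ->
  (0 < i <= c)%N ->
  exists s : seq F, [/\ forall z, z \in s -> lcs_comm 1 z,
    lcs_comm i `<=` lin_span ([set` s] `|` lcs_comm i.+1)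
    & (size s + (size xs - i) + \dim (lcs L i.+1) * size xs
       <= \dim (lcs L i) * size xs)%N].
Proof.
move=> nilL spanX ic; have [i0 _] := andP ic.
have [x0 [l [lxs szl w_pre]]] : exists x0 l, [/\ {subset x0 :: l <= xs},
    (size l).+1 = i & ~ lcs_pre i.+1 (foldl lie x0 l)].
  apply: contrapT => noword; apply: (nilpotent_lcs_neq nilL ic).
  apply/subvP => y; have [x <-] := pS y => /(lcs_pre_left_normed spanX i0).
  apply: (lin_span_min (lcs_pre_linear i.+1)) => u [[x0 [l [lxs szl ->]]]|//].
  by apply: contrapT => w_pre; apply: noword; exists x0, l.
set w := foldl lie x0 l in w_pre.
have wi : lcs_pre i w by apply: (@left_normed_pre xs); exists x0, l.
pose D := (lcs L i :\: (<[p w]> + lcs L i.+1))%VS.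
have DE : (D + (<[p w]> + lcs L i.+1) = lcs L i)%VS.
  rewrite addv_diff; apply/addv_idPl; rewrite subv_add lcs_succ_sub andbT.
  by rewrite -memvE.
have dimD : (\dim D + (\dim (lcs L i.+1)).+1 = \dim (lcs L i))%N.
  rewrite -[in RHS]DE dimv_disjoint_sum ?capv_diff // dimv_disjoint_sum.
    rewrite dim_vline; suff -> : p w != 0 by [].
    by apply/eqP => pw0; apply: w_pre; apply: ker_lcs_pre.
  apply/eqP; rewrite -subv0; apply/subvP => y; rewrite memv_cap memv0.
  case/andP => /vlineP[k ->]; have [->|k0] := eqVneq k 0; first by rewrite scale0r.
  move=> kw; case: w_pre; rewrite /lcs_pre /= -(scalerK k0 (p w)).
  exact: memvZ.
(* [w] followed by [bs] lifts a basis of [lcs L i] modulo [lcs L i.+1]. *)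
have [bs bsD] := map_lift (vbasis D).
have szbs : size bs = \dim D by rewrite -(size_map p) bsD size_tuple.
have bsi b : b \in bs -> lcs_pre i b.
  move=> /(map_f p); rewrite bsD => /vbasis_mem.
  exact: (subvP (diffvSl _ _)).
have Bi : [set` w :: bs] `<=` lcs_pre i.
  by move=> b /=; rewrite inE => /predU1P[->//|]; apply: bsi.
have spanB : lcs_pre i `<=` lin_span ([set` w :: bs] `|` lcs_pre i.+1).
  move=> x ix; apply: lift_span; rewrite /= span_cons bsD.
  by rewrite (span_basis (vbasisP D)) (addvC <[_]>%VS) -addvA DE.
pose s := [seq lie b x | b <- bs, x <- xs] ++ [seq lie w x | x <- undup (x0 :: l)].
exists s; split.
- by move=> z; rewrite mem_cat => /orP[/allpairsP[[b x] [_ _ ->]]|/mapP[x _ ->]];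
    apply/mem_lcs_comm/lcs_pre1.
- have bs_s b x : b \in bs -> x \in xs ->
      lin_span ([set` s] `|` lcs_comm i.+1) (lie b x).
    move=> bbs xxs; apply: sub_lin_span; left => /=.
    by rewrite mem_cat allpairs_f.
  apply: subset_trans (lcs_comm_span i0 spanX Bi spanB) _.
  apply: lin_span_min => // z [[b [x [+ xxs ->]]]|zi]; last first.
    by apply: sub_lin_span; right.
  rewrite /= inE => /predU1P[->|/bs_s bP]; last exact: bP.
  (* The elements [u] supplied here are arbitrary in [P i]; expanding them in
     the basis only produces, modulo [[P i.+1, F]], brackets of basis elements
     with letters of [w]. *)
  have := @lie_left_normed x0 l x 1 isT (lcs_pre1 x); rewrite addn1 szl.
  apply: lin_span_min => // _ [u [t [iu tl ->]]].
  apply: (@lie_lin_span _ _ _ [set t]) (spanB _ iu) _ => //; last first.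
    exact: sub_lin_span.
  move=> b' _ [+|ib] ->; last by apply: sub_lin_span; right; apply: mem_lcs_comm.
  rewrite /= inE => /predU1P[->|/bs_s bP]; last exact/bP/lxs.
  apply: sub_lin_span; left => /=.
  by rewrite mem_cat map_f ?orbT // mem_undup.
rewrite size_cat size_allpairs size_map szbs -dimD.
have := size_undup (x0 :: l); rewrite /= szl => sz1.
have sz2 : (size (undup (x0 :: l)) <= size xs)%N.
  by apply: uniq_leq_size (undup_uniq _) _ => t; rewrite mem_undup; apply: lxs.
rewrite mulnDl mulSn /= in sz1 sz2 *; lia.
Qed.

Lemma derived_generators c (xs : seq F) k :
  nilpotent_step L c -> (forall x, lin_span ([set` xs] `|` lcs_pre 2) x) ->
  (0 < k <= c)%N ->
  exists s : seq F, [/\ forall z, z \in s -> lcs_comm 1 z,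
    lcs_comm 1 `<=` lin_span ([set` s] `|` lcs_comm k.+1)
    & (size s + \sum_(2 <= i < k.+1) (size xs - i) + \dim (lcs L k.+1) * size xs
       <= 'C(size xs, 2) + \dim (lcs L 2) * size xs)%N].
Proof.
move=> nilL spanX; elim: k => // -[_ _|k IH /andP[_ kc]].
  have [s [szs sL sP]] := lie_pairs_span xs.
  exists s; split; last by rewrite szs big_geq // addn0.
    by move=> z /sL[x [y ->]]; apply/mem_lcs_comm/lcs_pre1.
  have := @lcs_comm_span [set` xs] [set` xs] 1 isT spanX.
  move/(_ (fun x _ => lcs_pre1 x) (fun x _ => spanX x)) => /subset_trans; apply.
  apply: lin_span_min => // z [[x [y [/= xxs yxs ->]]]|z2].
    by apply: lin_spanS (sP _ _ xxs yxs) => t; left.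
  by apply: sub_lin_span; right.
have [s [sL sP szs]] := IH (ltnW kc).
have [t [tL tP szt]] := @lcs_comm_generators c xs k.+2 nilL spanX kc.
exists (s ++ t); split.
- by move=> z; rewrite mem_cat => /orP[/sL|/tL].
- apply: subset_trans sP _; apply: lin_span_min => // z [/= zs|].
    by apply: sub_lin_span; left => /=; rewrite mem_cat zs.
  move/tP; apply: lin_spanS => y [/= yt|]; [left=> /=|by right].
  by rewrite mem_cat yt orbT.
by rewrite size_cat big_nat_recr //=; lia.
Qed.

(** The ends of the filtration are identified with the two ideals that define
    the multiplier; [lcs L 2] is the image of [[F, F]], so its dimension is
    subtracted from the number of generators. *)
Lemma schur_multiplier_bound c : nilpotent_step L c ->
  let d := (\dim {:L} - \dim (lcs L 2))%N in
  exists2 e, schur_multiplier_dim p e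
    & (e + \dim (lcs L 2) + \sum_(2 <= i < c.+1) (d - i)
       <= 'C(d, 2) + \dim (lcs L 2) * d)%N.
Proof.
move=> nilL d.
have [xs xsD] := map_lift (vbasis (fullv :\: lcs L 2)).
have szxs : size xs = d.
  rewrite -(size_map p) xsD size_tuple /d.
  by have := dimv_cap_compl fullv (lcs L 2); rewrite capfv; lia.
have spanX x : lin_span ([set` xs] `|` lcs_pre 2) x.
  apply: lift_span; rewrite xsD (span_basis (vbasisP _)) addv_diff.
  by rewrite (subvP (addvSl _ _)) ?memvf.
have c0 : (0 < c)%N by case: c nilL => // -[].
have [|s [sL sP szs]] := @derived_generators c xs c nilL spanX.
  by rewrite c0 /=.
have lcsc : lcs L c.+1 = 0%VS by case: nilL.
have comm1 : lcs_comm 1 = lie_comm setT setT.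
  by congr lie_comm; apply/seteqP; split=> // x _; apply: lcs_pre1.
have commc : lcs_comm c.+1 = lie_comm (lie_ker p) setT.
  congr lie_comm; apply/seteqP; split=> x; rewrite /lcs_pre /lie_ker /= lcsc memv0.
    by move/eqP.
  by move=> ->.
have [||||e eM eL] := @quot_dim_ker _ _ _ p (lcs_comm 1) (lcs_comm c.+1) s
  (lcs L 2) _ _ _ sL sP.
- exact: lcs_comm_linear.
- exact: lcs_comm_linear.
- move=> x /(lcs_comm_sub_pre (ltn0Sn c)); rewrite /lcs_pre /= lcs_succ //.
  rewrite lcsc => x0.
  apply/eqP; rewrite -memv0; apply: subvP x0; apply/lie_prodvP => u v.
  by rewrite memv0 => /eqP ->; rewrite lie0l mem0v.
- move=> y y2; have [x xy] := pS y.
  have [|z z1 xz] := @lcs_pre_comm_ker 1 x isT; first by rewrite /lcs_pre /= xy.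
  by exists z => //; apply/eqP; rewrite eq_sym -subr_eq0 -xy -linearB xz.
exists e; first by rewrite /schur_multiplier_dim -comm1 -commc.
move: szs; rewrite szxs lcsc dimv0 mul0n addn0; apply: leq_trans.
by rewrite leq_add2r.
Qed.

End Presentation.

Theorem theorem1p1 (K : fieldType) (L : vectLieAlgType K) (n m c : nat)
    (F : lieAlgType K) (p : {linear F -> L}) :
  nilpotent_step L c ->
  \dim {:L} = n ->
  \dim (lcs L 2) = m ->
  (1 <= m)%N ->
  free_presentation p ->
  exists2 d : nat, schur_multiplier_dim p d &
    d%:Q <= 1 / 2%:Q * (n%:Q - m%:Q - 1) * (n%:Q + m%:Q)
            - \sum_(2 <= i < (minn (n - m) c).+1) (n%:Q - m%:Q - i%:Q).
Proof.
move=> nilL dimL dimL2 _ [_ pM pS].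
have [e eM bound] := schur_multiplier_bound pM pS nilL; exists e => //.
have le_mn : (m <= n)%N by rewrite -dimL -dimL2 dimvS ?subvf.
move: bound; rewrite dimL dimL2 /=; have nE : n = (n - m + m)%N by rewrite subnK.
set k := (n - m)%N in nE *; rewrite {}nE in le_mn *; clearbody k => bound.
rewrite -!pmulrn (natrD _ k m).
(* Truncated subtraction makes the terms with [i > k] vanish, so the sum up to
   [c] is the sum up to [minn k c]. *)
have sumE : \sum_(2 <= i < (minn k c).+1) (k%:R + m%:R - m%:R - i%:Q)
    = (\sum_(2 <= i < c.+1) (k - i))%N%:R :> rat.
  rewrite (@big_nat_widen _ _ _ 2 (minn k c).+1 c.+1) ?ltnS ?geq_minr //.
  rewrite big_mkcond natr_sum /=; apply: eq_big_nat => i /andP[_ ic].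
  case: ifP => ik; last by have /eqP -> : (k - i == 0)%N by lia.
  by rewrite -pmulrn natrB; [ring | lia].
have bin_half : 'C(k, 2)%:R * 2%:R = k%:R * (k%:R - 1) :> rat.
  rewrite -natrM mulnC -mul_bin_diag bin1 natrM.
  by case: (k) => [|j]; rewrite ?mul0r // -[j.+1%:R]natr1 addrK.
rewrite sumE; move: bound; rewrite -(ler_nat rat) !natrD natrM.
have -> : 1 / (1 + 1)%:R = 2%:R^-1 :> rat by [].
set S := (\sum_(2 <= i < _) _)%N.
nra.
Qed.
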